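(* Let $0<\alpha\le 2/3$, $0<\beta<1$, $\alpha<\gamma$, $31/48\le\gamma<1$ and $s\ge 0$. Then there exists $n_0$ (depending on $\alpha,\beta,\gamma,s$) such that for every $n\ge n_0$: if $G$ is a graph of order $n$ with \[ q(G)>2\gamma n-\frac{s}{n}\quad\text{and}\quad \delta(G)\le(\gamma-\alpha)n, \] then there exists an induced subgraph $H\subseteq G$ with $|H|>(1-\beta)n$ satisfying at least one of: (i) $q(H)>2\gamma\left(1+\frac{\alpha\beta}{8}\right)|H|$; (ii) $q(H)>2\gamma|H|$ and $\delta(H)>(\gamma-\alpha)|H|$.
   Context: All graphs are finite and simple. $q(G)$ denotes the largest eigenvalue of the signless Laplacian $Q(G)=D(G)+A(G)$. $\delta(G)$ is the minimum degree and $|H|$ the number of vertices of $H$. *)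

(* Defs.v *)
From HB Require Import structures.
From mathcomp Require Import all_boot all_order all_algebra.
From mathcomp Require Import boolp classical_sets reals.
Set Implicit Arguments. Unset Strict Implicit. Unset Printing Implicit Defensive.
Import Order.TTheory GRing.Theory Num.Theory.
Local Open Scope ring_scope.

(* A simple graph on vertex set 'I_n is a symmetric irreflexive relation
   e : rel 'I_n.  Subgraphs induced on a vertex set S : {set 'I_n} are
   handled by indexing S by 'I_#|S| via enum_val. *)

Definition deg_in (n : nat) (e : rel 'I_n) (S : {set 'I_n}) (v : 'I_n) : nat :=
  #|[set u in S | e v u]|.

(* minimum degree of the induced subgraph G[S] (equals #|S| = 0 if S empty) *)
Definition mindeg (n : nat) (e : rel 'I_n) (S : {set 'I_n}) : nat :=
  \big[minn/#|S|]_(v in S) deg_in e S v.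

Definition signless_lap (R : realType) (n : nat) (e : rel 'I_n) (S : {set 'I_n})
  : 'M[R]_#|S| :=
  \matrix_(i, j) (if i == j then (deg_in e S (enum_val i))%:R
                  else (e (enum_val i) (enum_val j))%:R).

Definition is_largest_eigenvalue (R : realType) (m : nat) (A : 'M[R]_m) (l : R) : Prop :=
  eigenvalue A l /\ (forall l', eigenvalue A l' -> l' <= l).

Definition qsl (R : realType) (n : nat) (e : rel 'I_n) (S : {set 'I_n}) : R :=
  xget 0 [set l | is_largest_eigenvalue (signless_lap R e S) l].

(* Main.v *)
Require Import Defs.
From HB Require Import structures.
From mathcomp Require Import all_boot all_order all_algebra.
From mathcomp Require Import boolp classical_sets reals.
From mathcomp Require Import ring lra.
Set Implicit Arguments. Unset Strict Implicit. Unset Printing Implicit Defensive.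
Import Order.TTheory GRing.Theory Num.Theory.
Local Open Scope ring_scope.

(* Delete, again and again, a vertex v whose entry of a unit eigenvector has the
   least square y.  Testing the eigenvector on G - v gives
   q(G - v) (1 - y) >= q (1 - 2y) - 1 + |G| y, while the eigenequation at a vertex
   of degree d gives y (q^2 - 2qd + |G| d) <= d.  As long as the minimum degree is
   at most (gamma - alpha)|G|, this keeps |G| y away from 1, so each deletion raises
   q - 2 gamma |G| by at least c = gamma alpha / 4 (unless (i) already holds).  If the
   minimum degree never exceeds that threshold, the roughly beta n deletions
   accumulate a gain of c beta n, which exceeds the c beta (1 - beta) n needed
   for (i). *)

(** * Quadratic forms and the largest eigenvalue of a real symmetric matrix *)

Section SymmetricMatrix.
Variables (R : realType) (m : nat).
Implicit Types (A B : 'M[R]_m) (x y : 'rV[R]_m).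

Definition bform A x y : R := (x *m A *m y^T) 0 0.
Definition sqnorm x : R := \sum_i x 0 i ^+ 2.

Lemma bformE A x y : bform A x y = \sum_j (x *m A) 0 j * y 0 j.
Proof. by rewrite /bform mxE; apply: eq_bigr => j _; rewrite [y^T _ _]mxE. Qed.

Lemma bform1 x : bform 1%:M x x = sqnorm x.
Proof. by rewrite bformE mulmx1; apply: eq_bigr => i _; rewrite expr2. Qed.

Lemma bform_scalar (a : R) x : bform a%:M x x = a * sqnorm x.
Proof. by rewrite -bform1 /bform mul_mx_scalar mulmx1 -scalemxAl mxE. Qed.

Lemma bformB A B x y : bform (A - B) x y = bform A x y - bform B x y.
Proof. by rewrite /bform mulmxBr mulmxBl !mxE. Qed.

Lemma bformC A x y : A^T = A -> bform A x y = bform A y x.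
Proof.
move=> sA; rewrite /bform -[in RHS]sA.
by rewrite -[y in RHS]trmxK -!trmx_mul mulmxA [RHS]mxE.
Qed.

Lemma bform_line A x y (t : R) : A^T = A ->
  bform A (x + t *: y) (x + t *: y)
  = bform A x x + 2 * t * bform A x y + t ^+ 2 * bform A y y.
Proof.
move=> sA.
have -> : bform A (x + t *: y) (x + t *: y) = bform A x x + t * bform A x y
    + t * bform A y x + t ^+ 2 * bform A y y.
  rewrite /bform linearD linearZ /= !mulmxDl !mulmxDr -!scalemxAl -!scalemxAr.
  by rewrite !mxE; ring.
by rewrite (bformC y x sA); ring.
Qed.

Lemma sqnorm_ge0 x : 0 <= sqnorm x.
Proof. by apply: sumr_ge0 => i _; rewrite sqr_ge0. Qed.

Lemma sqnorm_gt0 x : x != 0 -> 0 < sqnorm x.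
Proof.
move=> x0; rewrite lt_def sqnorm_ge0 andbT; apply: contraNneq x0 => s0.
apply/eqP/rowP => i; rewrite mxE; apply/eqP; rewrite -sqrf_eq0.
by apply/eqP/(psumr_eq0P _ s0) => // j _; rewrite sqr_ge0.
Qed.

Lemma discriminant_le0 (a b c : R) :
  (forall t, 0 <= a + 2 * t * b + t ^+ 2 * c) -> b ^+ 2 <= a * c.
Proof.
move=> H; have [c0|c0] := eqVneq c 0.
  have [->|b0] := eqVneq b 0; first by rewrite c0 mulr0 expr0n.
  have := H (- (a + 1) / (2 * b)); rewrite c0 mulr0 addr0.
  have -> : a + 2 * (- (a + 1) / (2 * b)) * b = -1 by field.
  by rewrite leNgt ltrN10.
have c_ge0 : 0 <= c.
  rewrite leNgt; apply/negP => cn.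
  (* With this [t >= 1] the factor [2 * b + t * c] is negative, so multiplying it by [t] only lowers
     it, and the quadratic is at most [c - 1]. *)
  pose t := (1 + `|a| + `|2 * b|) / (- c) + 1.
  have t1 : 1 <= t by rewrite lerDr divr_ge0 ?addr_ge0 // ltW ?oppr_gt0.
  have tc : t * c = c - (1 + `|a| + `|2 * b|) by rewrite /t; field.
  have := H t; rewrite leNgt => /negP; apply.
  have := ler_norm a; have := ler_norm (2 * b); have := normr_ge0 a => h1 h2 h3.
  have -> : a + 2 * t * b + t ^+ 2 * c = a + t * (2 * b + t * c) by ring.
  rewrite tc.
  have : t * (2 * b + (c - (1 + `|a| + `|2 * b|))) <= 2 * b + (c - (1 + `|a| + `|2 * b|)).
    by rewrite -[leRHS]mul1r ler_wnM2r //; lra.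
  lra.
have cp : 0 < c by rewrite lt_def c0.
have := H (- b / c).
have -> : a + 2 * (- b / c) * b + (- b / c) ^+ 2 * c = (a * c - b ^+ 2) / c by field.
by rewrite pmulr_lge0 ?invr_gt0 // subr_ge0.
Qed.

Lemma psd_CauchySchwarz B x y : B^T = B -> (forall z, 0 <= bform B z z) ->
  bform B x y ^+ 2 <= bform B x x * bform B y y.
Proof.
move=> sB B0; apply: discriminant_le0 => t.
by rewrite -bform_line.
Qed.

(** Cauchy-Schwarz against each column; the constant is the squared Frobenius norm of [A]. *)
Lemma sqnorm_mulmx_bound A :
  exists2 K : R, 0 <= K & forall x, sqnorm (x *m A) <= K * sqnorm x.
Proof.
exists (\sum_j sqnorm (col j A)^T) => [|x]; first by apply: sumr_ge0 => j _; exact: sqnorm_ge0.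
rewrite mulr_suml; apply: ler_sum => j _; rewrite mulrC.
rewrite -!bform1; have -> : (x *m A) 0 j = bform 1%:M x (col j A)^T.
  by rewrite bformE mulmx1 mxE; apply: eq_bigr => i _; rewrite !mxE.
by apply: psd_CauchySchwarz => [|z]; rewrite ?trmx1 // bform1 sqnorm_ge0.
Qed.

Lemma bform_bound A :
  exists2 K : R, 0 <= K & forall x, bform A x x <= K * sqnorm x.
Proof.
have [K K0 HK] := sqnorm_mulmx_bound A.
exists (K + 1) => [|x]; first by rewrite addr_ge0.
rewrite mulrDl mul1r.
suff h : 2 * bform A x x <= sqnorm (x *m A) + sqnorm x.
  have := HK x; have := sqnorm_ge0 x; have := sqnorm_ge0 (x *m A); lra.
rewrite bformE mulr_sumr -big_split; apply: ler_sum => i _ /=.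
by have := sqr_ge0 ((x *m A) 0 i - x 0 i); nra.
Qed.

(** Take y = xB in Cauchy-Schwarz: |xB|^4 <= B(x,x) B(xB,xB) <= B(x,x) K |xB|^2, and cancel
    |xB|^2. *)
Lemma psd_sqnorm_bound B : B^T = B -> (forall z, 0 <= bform B z z) ->
  exists2 K : R, 0 <= K & forall x, sqnorm (x *m B) <= K * bform B x x.
Proof.
move=> sB B0; have [K K0 HK] := bform_bound B; exists K => // x.
have := psd_CauchySchwarz x (x *m B) sB B0.
have -> : bform B x (x *m B) = sqnorm (x *m B) by rewrite bformE; apply: eq_bigr => i _; rewrite expr2.
move=> h; have h2 := HK (x *m B).
have [->|n0] := eqVneq (sqnorm (x *m B)) 0; first by rewrite mulr_ge0.
have np : 0 < sqnorm (x *m B) by rewrite lt_def n0 sqnorm_ge0.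
rewrite -(ler_pM2r np) -expr2; apply: (le_trans h).
by rewrite mulrAC mulrC; apply: ler_wpM2r.
Qed.

(* l is the infimum of the Rayleigh upper bounds; if l - A were invertible, then
   psd_sqnorm_bound would make it bounded below by a positive multiple of the
   identity, contradicting minimality. *)
Lemma symmetric_largest_eigenvalue A : (0 < m)%N -> A^T = A ->
  exists l, is_largest_eigenvalue A l /\
    forall x, bform A x x <= l * sqnorm x.
Proof.
move=> m0 sA.
pose E := [set l : R | forall x, bform A x x <= l * sqnorm x]%classic.
have [K _ EK] := bform_bound A.
have lbE x : x != 0 -> lbound E (bform A x x / sqnorm x).
  by move=> x0 l; rewrite ler_pdivrMr ?sqnorm_gt0 //; exact.
have hE : has_inf E.
  split; first by exists K.
  exists (bform A (const_mx 1) (const_mx 1) / sqnorm (const_mx 1)); apply: lbE.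
  by apply/eqP => /rowP /(_ (Ordinal m0)); rewrite !mxE => /eqP; rewrite oner_eq0.
pose l := inf E.
have El : E l.
  move=> x; have [->|x0] := eqVneq x 0.
    by rewrite -bform1 /bform !mul0mx mxE mulr0.
  by rewrite -ler_pdivrMr ?sqnorm_gt0 //; apply: lb_le_inf; [case: hE|exact: lbE].
exists l; split=> //; split; last first.
  move=> l' /eigenvalueP [x xA x0].
  rewrite -(ler_pM2r (sqnorm_gt0 x0)); apply: le_trans (El x).
  by rewrite /bform xA -scalemxAl mxE -[x in x *m _]mulmx1 -/(bform 1%:M x x) bform1.
pose B := l%:M - A.
have sB : B^T = B by rewrite /B linearB /= tr_scalar_mx sA.
have BE x : bform B x x = l * sqnorm x - bform A x x by rewrite bformB bform_scalar.
have B0 x : 0 <= bform B x x by rewrite BE subr_ge0.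
have [|dB] := boolP (\det B == 0).
  move=> /det0P [x x0 xB]; apply/eigenvalueP; exists x => //.
  by move/eqP: xB; rewrite mulmxBr mul_mx_scalar subr_eq0 => /eqP.
have uB : B \in unitmx by rewrite unitmxE unitfE.
have [K1 K10 HK1] := sqnorm_mulmx_bound (invmx B).
have [K2 K20 HK2] := psd_sqnorm_bound sB B0.
(* Chaining the two bounds gives |x|^2 <= C B(x,x); the added 1 keeps [C] invertible. *)
pose C := K1 * K2 + 1.
have C0 : 0 < C by rewrite ltr_wpDl // mulr_ge0.
have : E (l - C^-1).
  move=> x; rewrite mulrBl lerBrDr -lerBrDl -BE mulrC ler_pdivrMr //.
  have := HK1 (x *m B); rewrite mulmxK // => h; apply: (le_trans h).
  apply: (le_trans (ler_wpM2l K10 (HK2 x))).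
  by rewrite mulrA mulrC ler_wpM2l // lerDl.
move=> /(ge_inf (proj2 hE)); rewrite -/l lerBrDr gerDl.
by rewrite leNgt invr_gt0 C0.
Qed.

End SymmetricMatrix.

(** * Signless Laplacians of induced subgraphs, and deletion of a vertex *)

Section SignlessLaplacian.
Variables (R : realType) (n : nat) (e : rel 'I_n).
Hypotheses (syme : symmetric e) (irre : irreflexive e).
Implicit Types (S : {set 'I_n}) (f : 'I_n -> R).

(** Acting on functions on all of ['I_n] lets the same [f] be tested on [S] and on [S :\ v] without
    reindexing. *)
Definition signless_op S f (u : 'I_n) : R :=
  (deg_in e S u)%:R * f u + \sum_(v in S | e u v) f v.

Lemma mul_signless_lap S f j :
  ((\row_i f (enum_val i)) *m signless_lap R e S) 0 j
  = signless_op S f (enum_val j).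
Proof.
rewrite /signless_op big_mkcondr big_enum_val mxE.
rewrite [RHS]addrC (bigD1 j) //= [in RHS](bigD1 j) //= irre add0r addrC !mxE eqxx mulrC.
congr (_ + _); apply: eq_bigr => i /negPf ij; rewrite !mxE ij syme.
by case: (e _ _); rewrite ?mulr1 ?mulr0.
Qed.

Lemma tr_signless_lap S : (signless_lap R e S)^T = signless_lap R e S.
Proof.
apply/matrixP => i j; rewrite !mxE eq_sym syme.
by case: eqP => [->|].
Qed.

(** A largest eigenvalue exists and is unique, so the default 0 of [xget] never intervenes for
    nonempty [S]. *)
Lemma qsl_spec S : (0 < #|S|)%N ->
  is_largest_eigenvalue (signless_lap R e S) (qsl R e S) /\
  forall x, bform (signless_lap R e S) x x <= qsl R e S * sqnorm x.
Proof.
move=> S0; have [l [lmax lR]] := symmetric_largest_eigenvalue S0 (tr_signless_lap S).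
have qmax : is_largest_eigenvalue (signless_lap R e S) (qsl R e S).
  by apply: (@xgetPex _ 0 [set l | is_largest_eigenvalue (signless_lap R e S) l]%classic); exists l.
suff -> : qsl R e S = l by [].
by apply/eqP; rewrite eq_le (proj2 lmax) ?(proj2 qmax) //; [case: lmax|case: qmax].
Qed.

Lemma qsl_rayleigh S f : (0 < #|S|)%N ->
  \sum_(u in S) f u * signless_op S f u <= qsl R e S * \sum_(u in S) f u ^+ 2.
Proof.
move=> /qsl_spec [_ /(_ (\row_i f (enum_val i)))].
congr (_ <= _ * _).
  rewrite bformE [RHS]big_enum_val; apply: eq_bigr => i _.
  by rewrite mul_signless_lap mxE mulrC.
by rewrite [RHS]big_enum_val; apply: eq_bigr => i _; rewrite mxE.
Qed.

Lemma qsl_eigenfunction S : (0 < #|S|)%N ->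
  exists2 f, \sum_(u in S) f u ^+ 2 = 1 &
    {in S, forall u, signless_op S f u = qsl R e S * f u}.
Proof.
move=> S0; have [[/eigenvalueP [x xQ x0] _] _] := qsl_spec S0.
have /card_gt0P [u0 u0S] := S0.
pose c := (Num.sqrt (sqnorm x))^-1; pose y := c *: x.
(* Outside [S] the values of [f] are arbitrary; only those on [S] are read. *)
pose f u := y 0 (enum_rank_in u0S u).
have fy : \row_i f (enum_val i) = y.
  by apply/rowP => i; rewrite mxE /f enum_valK_in.
exists f => [|u uS].
  rewrite big_enum_val /=.
  under eq_bigr => i _ do rewrite /f enum_valK_in mxE exprMn.
  rewrite -mulr_sumr -/(sqnorm x) /c exprVn sqr_sqrtr ?sqnorm_ge0 //.
  by rewrite mulVf // gt_eqF ?sqnorm_gt0.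
rewrite -(enum_rankK_in u0S uS) -mul_signless_lap fy /y -scalemxAl xQ.
by rewrite /f enum_valK_in /y !mxE; ring.
Qed.

Lemma exists_deg_le_mindeg S : (0 < #|S|)%N ->
  exists2 u, u \in S & (deg_in e S u <= mindeg e S)%N.
Proof.
move=> /card_gt0P [u0 u0S]; rewrite /mindeg.
apply: (big_ind (fun k => exists2 u, u \in S & (deg_in e S u <= k)%N)).
- exists u0 => //; rewrite /deg_in; apply: subset_leq_card.
  by apply/fintype.subsetP => u; rewrite inE => /andP [].
- move=> a b [u uS ua] [v vS vb]; rewrite /minn.
  by case: ifP => _; [exists u|exists v].
- by move=> u uS; exists u.
Qed.

Lemma deg_in_sum S u : (deg_in e S u)%:R = \sum_(v in S | e u v) (1 : R).
Proof.
rewrite sumr_const /deg_in; congr (_%:R); apply: eq_card => v.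
by rewrite !inE.
Qed.

(** The form is the sum of (f u + f w)^2 over the edges uw, and deleting [v] loses exactly the edges
    at [v]. *)
Lemma signless_form_delete S f v : v \in S ->
  \sum_(u in S) f u * signless_op S f u =
  \sum_(u in S :\ v) f u * signless_op (S :\ v) f u
  + \sum_(u in S | e v u) (f u + f v) ^+ 2.
Proof.
move=> vS.
have split_sum (g : 'I_n -> R) u :
    \sum_(w in S | e u w) g w
    = (if e u v then g v else 0) + \sum_(w in S :\ v | e u w) g w.
  rewrite big_mkcondr (big_setD1 v) //=; congr (_ + _).
  by rewrite [RHS]big_mkcondr.
rewrite (big_setD1 v) //=.
have -> : \sum_(u in S :\ v) f u * signless_op S f u =
    \sum_(u in S :\ v) f u * signless_op (S :\ v) f u +
    \sum_(u in S :\ v | e v u) (f u ^+ 2 + f u * f v).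
  rewrite [X in _ + X]big_mkcondr -big_split; apply: eq_bigr => u _ /=.
  rewrite /signless_op !deg_in_sum !split_sum syme.
  by case: ifP => _; ring.
rewrite addrCA; congr (_ + _).
rewrite /signless_op deg_in_sum (split_sum (fun=> 1)) !split_sum irre !add0r.
rewrite mulrDr mulrA [f v * _]mulrC -mulrA mulr_suml mulr_sumr -!big_split.
by apply: eq_bigr => u _ /=; ring.
Qed.

(** Each of the |S| - deg(v) vertices of [S] not adjacent to [v] takes at least [y] of the total
    mass 1. *)
Lemma sum_nbr_le S f y v : {in S, forall u, y <= f u ^+ 2} ->
  \sum_(u in S) f u ^+ 2 = 1 ->
  \sum_(u in S | e v u) f u ^+ 2 <= 1 - (#|S|%:R - (deg_in e S v)%:R) * y.
Proof.
move=> ymin f1.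
have -> : #|S|%:R = (deg_in e S v)%:R + \sum_(u in S | ~~ e v u) (1 : R).
  by rewrite deg_in_sum -bigID /= sumr_const.
rewrite addrAC subrr add0r -[X in X - _]f1 [in leRHS](bigID (e v)) /= -addrA lerDl subr_ge0.
rewrite mulr_suml; apply: ler_sum => u /andP [uS _].
by rewrite mul1r ymin.
Qed.

(** The deleted [v] minimises f^2 and y = f(v)^2, while [u] is free; it will be a vertex of small
    degree, where the eigenequation forces [y] to be small. *)
Lemma qsl_delete_vertex S u : (1 < #|S|)%N -> u \in S ->
  exists2 v, v \in S & exists y : R,
    [/\ 0 <= y, #|S|%:R * y <= 1,
     y * (qsl R e S ^+ 2 - 2 * qsl R e S * (deg_in e S u)%:R
          + #|S|%:R * (deg_in e S u)%:R) <= (deg_in e S u)%:R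
     & qsl R e S * (1 - 2 * y) - 1 + #|S|%:R * y <= qsl R e (S :\ v) * (1 - y)].
Proof.
move=> S1 uS; have [f f1 fQ] := qsl_eigenfunction (ltnW S1).
set q := qsl R e S.
have nbr w : w \in S -> \sum_(z in S | e w z) f z = (q - (deg_in e S w)%:R) * f w.
  by move=> wS; have := fQ w wS; rewrite /signless_op -/q => h; lra.
pose v := [arg min_(w < u in S) f w ^+ 2]%O.
have [vS vmin] : v \in S /\ {in S, forall w, f v ^+ 2 <= f w ^+ 2}.
  by rewrite /v; case: arg_minP.
exists v => //; exists (f v ^+ 2); split; first exact: sqr_ge0.
- rewrite -[leRHS]f1 -sum1_card natr_sum mulr_suml; apply: ler_sum => w wS.
  by rewrite mul1r vmin.
- set d := (deg_in e S u)%:R; set m := #|S|%:R.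
  (* Cauchy-Schwarz over the neighbours of [u], against the constant 1. *)
  have CS : ((q - d) * f u) ^+ 2 <= d * \sum_(w in S | e u w) f w ^+ 2.
    apply: discriminant_le0 => t; rewrite -nbr // /d deg_in_sum.
    rewrite !mulr_sumr -!big_split; apply: sumr_ge0 => w _ /=.
    by have := sqr_ge0 (1 + t * f w); nra.
  have h1 := sum_nbr_le u vmin f1; rewrite -/d -/m in h1.
  have d0 : 0 <= d by apply: ler0n.
  have h2 := ler_wpM2l d0 h1.
  have h3 := ler_wpM2l (sqr_ge0 (q - d)) (vmin u uS).
  move: CS h2 h3; rewrite exprMn; move: (\sum_(w in S | _) _) => t; nra.
have S'0 : (0 < #|S :\ v|)%N by rewrite (cardsD1 v) vS in S1.
have := qsl_rayleigh f S'0.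
have -> : \sum_(w in S :\ v) f w ^+ 2 = 1 - f v ^+ 2.
  by rewrite -[X in X - _]f1 [in RHS](big_setD1 v) //= addrAC subrr add0r.
apply: le_trans.
have -> : \sum_(w in S :\ v) f w * signless_op (S :\ v) f w
   = q - \sum_(w in S | e v w) (f w + f v) ^+ 2.
  apply/eqP; rewrite eq_sym subr_eq -signless_form_delete //.
  rewrite -[q]mulr1 -[X in q * X]f1 mulr_sumr; apply/eqP/eq_bigr => w wS.
  by rewrite fQ // -/q; ring.
have -> : \sum_(w in S | e v w) (f w + f v) ^+ 2
   = \sum_(w in S | e v w) f w ^+ 2 + 2 * f v * \sum_(w in S | e v w) f w
     + (deg_in e S v)%:R * f v ^+ 2.
  rewrite deg_in_sum mulr_suml mulr_sumr -!big_split.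
  by apply: eq_bigr => w _ /=; ring.
(* The lost sum is at most 1 - (|S| - d)y + 2(q - d)y + dy, in which the degree d of [v] cancels. *)
rewrite nbr //; have := sum_nbr_le v vmin f1; nra.
Qed.

End SignlessLaplacian.

(** Scaling by [m] (z = q/m, x = d/m, p = my) puts z within [c] of 2g, which yields p <= (g - a)/(g
    - a + 12c). The claimed gain reduces to [key], an upper bound on p. *)
Lemma deletion_gain (R : realType) (g a m q q' y d eta : R) :
  let c := g * a / 4 in
  0 < a -> a < g -> 4 / 7 <= g -> g < 1 ->
  2 < m -> 2 <= c * m -> eta <= c * m ->
  d <= (g - a) * m -> 0 <= y -> m * y <= 1 ->
  2 * g * m - eta <= q -> q <= (2 * g + c) * m ->
  y * (q ^+ 2 - 2 * q * d + m * d) <= d ->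
  q * (1 - 2 * y) - 1 + m * y <= q' * (1 - y) ->
  q - 2 * g + c <= q'.
Proof.
move=> c a0 ag g47 g1 m2 cm etam dm y0 my1 qlo qhi hy hq'.
have c0 : 0 < c by rewrite /c; nra.
have m0 : 0 < m by lra.
have y1 : 0 < 1 - y by nra.
pose p := m * y.
pose z := q / m; have qz : q = z * m by rewrite /z divfK // gt_eqF.
pose x := d / m; have dx : d = x * m by rewrite /x divfK // gt_eqF.
have zlo : 2 * g - c <= z by rewrite -(ler_pM2r m0) -qz; lra.
have zhi : z <= 2 * g + c by rewrite -(ler_pM2r m0) -qz.
have xg : x <= g - a by rewrite -(ler_pM2r m0) -dx.
have hp : p * (z ^+ 2 - 2 * z * x + x) <= x.
  rewrite -(ler_pM2r m0) -dx; apply: le_trans hy.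
  suff -> : p * (z ^+ 2 - 2 * z * x + x) * m = y * (q ^+ 2 - 2 * q * d + m * d) by [].
  by rewrite qz dx /p; ring.
have cE : g * a = 4 * c by rewrite /c; field.
have c1 : 4 * c <= 1 by rewrite -cE; nra.
have z12 : 1 <= 2 * z by lra.
have p0 : 0 <= p by rewrite mulr_ge0 // ltW.
(* As 2z >= 1, raising x to its upper bound g - a preserves the inequality. *)
have hp2 : p * (z ^+ 2 - 2 * z * (g - a) + (g - a)) <= g - a.
  have : 0 <= p * ((2 * z - 1) * (g - a - x)).
    by rewrite mulr_ge0 // mulr_ge0 //; lra.
  lra.
have hz : 12 * c <= z ^+ 2 - 2 * z * (g - a).
  (* This product is z^2 - 2z(g - a) minus its value at the least admissible z = 2g - c. *)
  have h1 : 0 <= (z - (2 * g - c)) * (z + 2 * a - c) by rewrite mulr_ge0 //; lra.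
  have h2 : 0 <= c * (4 - 2 * (g + a) + c) by rewrite mulr_ge0 //; lra.
  have -> : 12 * c = (2 * g - c) * (2 * a - c) - c * (4 - 2 * (g + a) + c).
    have -> : 12 * c = 4 * (g * a) - 4 * c by rewrite cE; ring.
    ring.
  lra.
have hp3 : p * (12 * c + (g - a)) <= g - a.
  by apply: le_trans hp2; rewrite ler_wpM2l // lerD2r.
have key : p * (2 * g - 1 + 2 * c) <= 2 * g - 1 - c.
  have D0 : 0 < 12 * c + (g - a) by lra.
  rewrite -(ler_pM2r D0) mulrAC.
  apply: (@le_trans _ _ ((g - a) * (2 * g - 1 + 2 * c))).
    by rewrite ler_wpM2r //; lra.
  have h1 : 0 <= a * (1 - g) by rewrite mulr_ge0 //; lra.
  (* Three times this is the slack in [key] after clearing the denominator; here g >= 4/7 enters. *)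
  have h2 : 0 <= c * (7 * g - 4 + a * (1 - g)) by rewrite mulr_ge0 //; lra.
  suff : (2 * g - 1 - c) * (12 * c + (g - a)) - (g - a) * (2 * g - 1 + 2 * c)
      = 3 * (c * (7 * g - 4 + a * (1 - g))) by lra.
  have -> : 7 * g - 4 + a * (1 - g) = 7 * g - 4 + a - 4 * c by rewrite -cE; ring.
  ring.
suff : (q - 2 * g + c) * (1 - y) <= q' * (1 - y) by rewrite ler_pM2r.
apply: le_trans hq'.
suff : y * (q - m + 2 * g - c) <= 2 * g - 1 - c by lra.
(* The term 2g - c is below 2 and is absorbed by [c * m]. *)
apply: le_trans key; rewrite /p [m * y]mulrC -mulrA ler_wpM2l //; lra.
Qed.

(** * Iterated deletion *)

Theorem theorem3p4 (R : realType) (alpha beta gamma s : R) :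
  0 < alpha -> alpha <= 2 / 3 -> 0 < beta -> beta < 1 -> alpha < gamma ->
  31 / 48 <= gamma -> gamma < 1 -> 0 <= s ->
  exists n0 : nat, forall n : nat, (n0 <= n)%N ->
  forall e : rel 'I_n, symmetric e -> irreflexive e ->
  2 * gamma * n%:R - s / n%:R < qsl R e [set: 'I_n] ->
  (mindeg e [set: 'I_n])%:R <= (gamma - alpha) * n%:R ->
  exists S : {set 'I_n},
    (1 - beta) * n%:R < #|S|%:R /\
    (2 * gamma * (1 + alpha * beta / 8) * #|S|%:R < qsl R e S \/
     (2 * gamma * #|S|%:R < qsl R e S /\
      (gamma - alpha) * #|S|%:R < (mindeg e S)%:R)).
Proof.
move=> a0 _ b0 b1 ag g3148 g1 s0.
pose c := gamma * alpha / 4.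
have ga0 : 0 < gamma * alpha by rewrite mulr_gt0 // (lt_trans a0).
have c0 : 0 < c by rewrite /c; lra.
have ga1 : gamma * alpha < 1.
  by apply: (@lt_trans _ _ gamma) => //; rewrite gtr_pMr; lra.
have c14 : 4 * c <= 1 by rewrite /c; lra.
have b10 : 0 < 1 - beta by lra.
have T1 : 0 <= 2 / (c * (1 - beta)) by rewrite divr_ge0 // mulr_ge0 // ltW.
have T2 : 0 <= s / c by rewrite divr_ge0 // ltW.
have T3 : 0 <= 3 / beta ^+ 2 by rewrite divr_ge0 // sqr_ge0.
(* The summands give, in turn, [n1] (so cm >= 2 at every stage), [n2] and [n3] (for the final
   contradiction). *)
pose T := 2 / (c * (1 - beta)) + s / c + 3 / beta ^+ 2.
have T0 : 0 <= T by rewrite !addr_ge0.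
exists (Num.bound T) => n nT e syme irre qn degn.
have Tn : T < n%:R by apply: lt_le_trans (archi_boundP T0) _; rewrite ler_nat.
have n0 : 0 < n%:R :> R by apply: le_lt_trans Tn.
have n1 : 2 <= c * ((1 - beta) * n%:R).
  rewrite mulrA mulrC -ler_pdivrMr ?mulr_gt0 //; move: Tn; rewrite /T; lra.
have n2 : s / n%:R < c.
  rewrite ltr_pdivrMr // mulrC -ltr_pdivrMr //; move: Tn; rewrite /T; lra.
have n3 : 3 < beta ^+ 2 * n%:R.
  rewrite mulrC -ltr_pdivrMr ?exprn_gt0 //; move: Tn; rewrite /T; lra.
apply: contrapT => noS.
(* Failure of (i) and of (ii); note that c beta = 2 gamma alpha beta / 8. *)
have bad (S : {set 'I_n}) : (1 - beta) * n%:R < #|S|%:R ->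
    qsl R e S <= 2 * gamma * #|S|%:R + c * beta * #|S|%:R /\
    (2 * gamma * #|S|%:R < qsl R e S ->
     (mindeg e S)%:R <= (gamma - alpha) * #|S|%:R).
  move=> hS; split.
    rewrite leNgt; apply/negP => h; apply: noS; exists S; split=> //; left.
    by move: h; congr (_ < _); rewrite /c; field.
  by move=> hq; rewrite leNgt; apply/negP => h; apply: noS; exists S; split=> //; right.
(* After [k] deletions the excess of q over 2 gamma m is at least ck - s/n, and the degree bound
   persists. *)
have chain k : forall m, (m + k = n)%N -> (1 - beta) * n%:R < m%:R ->
    exists2 S : {set 'I_n}, #|S| = m &
      2 * gamma * m%:R + c * k%:R - s / n%:R <= qsl R e S /\
      (mindeg e S)%:R <= (gamma - alpha) * m%:R.
  elim: k => [|k IH] m mk hm.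
    exists [set: 'I_n]; first by rewrite cardsT card_ord -mk addn0.
    have -> : m = n by rewrite -mk addn0.
    by rewrite mulr0 addr0 ltW.
  have [|S Sm [qS degS]] := IH m.+1 (etrans (addSnnS m k) mk).
    by apply: lt_trans hm _; rewrite ltr_nat.
  have mS1 : m.+1%:R = m%:R + 1 :> R by rewrite -natr1.
  have cm : 2 < c * m.+1%:R.
    by apply: le_lt_trans n1 _; rewrite ltr_pM2l //; rewrite mS1; lra.
  have m8 : 8 < m.+1%:R :> R.
    rewrite -(ltr_pM2l c0); lra.
  have S1 : (1 < #|S|)%N.
    by rewrite Sm -(@ltr_nat R); lra.
  have [u uS udeg] := exists_deg_le_mindeg e (ltnW S1).
  have [v vS [y [y0 my1 hy hq']]] := qsl_delete_vertex R syme irre S1 uS.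
  have S'm : #|S :\ v| = m.
    by move: (cardsD1 v S); rewrite vS Sm add1n => -[].
  rewrite Sm in my1 hy hq'.
  have k0 : 0 <= c * k%:R by rewrite mulr_ge0 // ltW.
  have qS_le : qsl R e S <= 2 * gamma * #|S|%:R + c * beta * #|S|%:R.
    by apply: (proj1 (bad S _)); rewrite Sm mS1; lra.
  rewrite Sm in qS_le.
  have gain : qsl R e S - 2 * gamma + c <= qsl R e (S :\ v).
    apply: (@deletion_gain R gamma alpha m.+1%:R _ _ y (deg_in e S u)%:R (s / n%:R)) => //.
    - lra.
    - lra.
    - exact: ltW.
    - by rewrite -/c; lra.
    - by apply: le_trans degS; rewrite ler_nat.
    - lra.
    - rewrite -/c; apply: (le_trans qS_le); rewrite [leRHS]mulrDl lerD2l ler_pM2r; last by lra.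
      by rewrite ger_pMr // ltW.
  have q' : 2 * gamma * m%:R + c * k.+1%:R - s / n%:R <= qsl R e (S :\ v).
    by apply: le_trans gain; rewrite -natr1 mS1 in qS *; lra.
  exists (S :\ v) => //; split=> //.
  (* Since s/n < c, a single gain makes q exceed 2 gamma m, so failure of (ii) gives the degree
     bound. *)
  rewrite -S'm; apply: (proj2 (bad (S :\ v) _)); rewrite S'm //.
  by apply: lt_le_trans q'; rewrite -natr1; lra.
(* The least order still above (1 - beta)n. *)
pose m := (Num.truncn ((1 - beta) * n%:R)).+1.
have /andP [mlo mhi] : (Num.truncn ((1 - beta) * n%:R))%:R <= (1 - beta) * n%:R < m%:R.
  by apply: truncn_itv; rewrite mulr_ge0 // ltW.
have mE : (Num.truncn ((1 - beta) * n%:R))%:R = m%:R - 1 :> R.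
  by rewrite /m -natr1 addrK.
have mn : (m <= n)%N.
  rewrite /m -(@ltr_nat R); apply: le_lt_trans mlo _; rewrite gtr_pMl //; lra.
have [S Sm [qS _]] := chain (n - m)%N m (subnKC mn) mhi.
have [|qS_le _] := bad S; first by rewrite Sm.
rewrite Sm in qS_le; rewrite natrB // in qS; rewrite mE in mlo.
(* From c(n - m) - s/n <= c beta m and m <= (1 - beta)n + 1 follows c beta^2 n <= c(1 + beta) + s/n
   < 3c, against [n3]. *)
have h1 : c * n%:R - s / n%:R <= c * ((1 + beta) * m%:R) by lra.
have h2 : c * ((1 + beta) * m%:R) <= c * ((1 + beta) * ((1 - beta) * n%:R + 1)).
  by rewrite !ler_pM2l //; lra.
have h3 : c * 3 < c * (beta ^+ 2 * n%:R) by rewrite ltr_pM2l.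
have h4 : c * beta < c by rewrite gtr_pMr.
move: h1 h2 h3 h4 n2; move: (s / n%:R) => w; clear; lra.
Qed.
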